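(* Let $(E;\oplus,0,1)$ be a sharply dominating Archimedean atomic lattice effect algebra and let $S(E)=\{x\in E\mid x\wedge x'=0\}$. Then for every $(o)$-continuous state $\omega$ on $S(E)$ there exists a state $\hat\omega$ on $E$ such that $\hat\omega|_{S(E)}=\omega$.
   Context: An effect algebra $(E;\oplus,0,1)$ is a set $E$ with two distinguished elements $0,1$ and a partially defined binary operation $\oplus$ such that for all $a,b,c\in E$: (Ei) $a\oplus b=b\oplus a$ if $a\oplus b$ is defined; (Eii) $(a\oplus b)\oplus c=a\oplus(b\oplus c)$ if one side is defined; (Eiii) for each $a$ there is a unique $b$, denoted $a'$, with $a\oplus b=1$; (Eiv) if $1\oplus a$ is defined then $a=0$. The partial order is given by: $a\leq b$ iff there is $c$ with $a\oplus c$ defined and equal to $b$; $a\oplus b$ is defined iff $b\leq a'$. $E$ is a lattice effect algebra if $(E,\leq)$ is a lattice. A nonzero element $a$ is an atom if $0\leq b<a$ implies $b=0$; $E$ is atomic if for every nonzero $x\in E$ there is an atom $a\leq x$. $E$ is Archimedean if for no nonzero $e\in E$ do the elements $ne=e\oplus\dots\oplus e$ ($n$ times) exist for all positive integers $n$. Elements of $S(E)$ are called sharp; $E$ is sharply dominating if for every $a\in E$ there exists a smallest sharp element $\hat a$ with $a\leq\hat a$ (i.e. $\hat a\in S(E)$, $a\leq\hat a$, and $b\in S(E)$, $a\leq b$ imply $\hat a\leq b$). For a lattice effect algebra $E$ it is known that $S(E)$ is a sublattice and a sub-effect algebra of $E$ (hence an effect algebra in its own right under the inherited $\oplus$) and is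 an orthomodular lattice. A state on an effect algebra $E$ is a map $\omega:E\to[0,1]$ with $\omega(1)=1$ and $\omega(x\oplus y)=\omega(x)+\omega(y)$ whenever $x\leq y'$. A net $(a_\alpha)$ in a poset $P$ order converges to $a\in P$, written $a_\alpha\xrightarrow{(o)}a$, if there are nets $(u_\alpha)$, $(v_\alpha)$ in $P$ over the same index set with $u_\alpha\leq a_\alpha\leq v_\alpha$ for all $\alpha$, $u_\alpha\uparrow a$ and $v_\alpha\downarrow a$; here $u_\alpha\uparrow a$ means $u_\alpha\leq u_\beta$ for all $\alpha\leq\beta$ and $a=\bigvee_\alpha u_\alpha$, and $v_\alpha\downarrow a$ is dual. A state $\omega$ is $(o)$-continuous if $x_\alpha\xrightarrow{(o)}x$ implies $\omega(x_\alpha)\to\omega(x)$ for every net $(x_\alpha)$; for a state on $S(E)$ this refers to nets and order convergence in the poset $S(E)$. *)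

(* Defs.v *)
From HB Require Import structures.
From mathcomp Require Import all_boot all_order all_algebra.
From mathcomp Require Import all_classical all_reals all_analysis.

Set Implicit Arguments.
Unset Strict Implicit.
Unset Printing Implicit Defensive.

Import Order.TTheory GRing.Theory Num.Theory.
Import numFieldNormedType.Exports.

Local Open Scope classical_set_scope.
Local Open Scope order_scope.

(* The partial operation is option-valued: [oplus a b = None] means that the
   sum is undefined. Equations between options thus say that each side is
   defined as soon as the other one is. The order is determined by [oplus]
   through [le_oplus]; it is bundled so that MathComp's order theory applies. *)
HB.mixin Record isEffectAlgebra (d : Order.disp_t) (E : Type)
    of Order.POrder d E := {
  ea0 : E;
  ea1 : E;
  oplus : E -> E -> option E;
  oplusC : forall a b, oplus a b = oplus b a;
  oplusA : forall a b c,
    obind (fun s => oplus s c) (oplus a b) =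
    obind (fun s => oplus a s) (oplus b c);
  orth_exists_unique : forall a, exists! b, oplus a b = Some ea1;
  oplus1_defined : forall a, oplus ea1 a -> a = ea0;
  le_oplus : forall a b : E, a <= b <-> exists c, oplus a c = Some b
}.

#[short(type="effectAlgebraType")]
HB.structure Definition EffectAlgebra d :=
  { E of isEffectAlgebra d E & Order.POrder d E }.

#[short(type="latticeEffectAlgebraType")]
HB.structure Definition LatticeEffectAlgebra d :=
  { E of EffectAlgebra d E & Order.Lattice d E }.

Section EffectAlgebraTheory.
Context {d : Order.disp_t} {E : effectAlgebraType d}.
Implicit Types a b c x y z : E.

Lemma orth_exists a : exists b, oplus a b == Some ea1.
Proof. by have [b [/eqP ab _]] := orth_exists_unique a; exists b. Qed.

Definition orth a : E := xchoose (orth_exists a).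

Lemma oplus_orth a : oplus a (orth a) = Some ea1.
Proof. exact/eqP/(xchooseP (orth_exists a)). Qed.

Lemma orth_unique a b : oplus a b = Some ea1 -> b = orth a.
Proof.
have [c [_ cP]] := orth_exists_unique a => /cP <-.
by apply: cP; exact: oplus_orth.
Qed.

Lemma orthK a : orth (orth a) = a.
Proof. by apply/esym/orth_unique; rewrite oplusC oplus_orth. Qed.

Lemma orth1 : orth ea1 = ea0 :> E.
Proof. by apply: oplus1_defined; rewrite oplus_orth. Qed.

Lemma orth0 : orth ea0 = ea1 :> E.
Proof. by rewrite -orth1 orthK. Qed.

Lemma oplusAs a b c s t : oplus a b = Some s -> oplus s c = Some t ->
  exists2 r, oplus b c = Some r & oplus a r = Some t.
Proof.
move=> ab sc; have := oplusA a b c.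
by rewrite ab /= sc; case: (oplus b c) => //= r /esym ar; exists r.
Qed.

Lemma oplus0 a : oplus a ea0 = Some a.
Proof.
have h : oplus ea0 ea1 = Some (ea1 : E) by rewrite -{1}orth0 oplus_orth.
have h1 : oplus (orth a) a = Some ea1 by rewrite oplusC oplus_orth.
rewrite oplusC in h.
have [r ar oar] := oplusAs h1 h.
by rewrite ar (orth_unique oar) orthK.
Qed.

Lemma oplus_orth_sum a b s : oplus a b = Some s ->
  oplus b (orth s) = Some (orth a).
Proof.
move=> ab; have [r -> /orth_unique ->//] := oplusAs ab (oplus_orth s).
Qed.

Lemma oplus_inj a b c s : oplus a b = Some s -> oplus a c = Some s -> b = c.
Proof.
have key x y z : oplus x y = Some z -> oplus x (orth z) = Some (orth y).
  by move=> h; apply: oplus_orth_sum; rewrite oplusC.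
by move=> /key h1 /key; rewrite h1 => -[/(congr1 orth)]; rewrite !orthK.
Qed.

Lemma oplus_definedE a b : (oplus a b : bool) = (b <= orth a).
Proof.
apply/idP/idP => [|/le_oplus[c bc]].
  case ab : (oplus a b) => [s|//] _.
  by apply/le_oplus; exists (orth s); apply: oplus_orth_sum ab.
have h : oplus (orth a) a = Some ea1 by rewrite oplusC oplus_orth.
rewrite oplusC in bc; have [r] := oplusAs bc h.
by rewrite oplusC => ->.
Qed.

Lemma le_oplusl a b s : oplus a b = Some s -> a <= s.
Proof. by move=> ab; apply/le_oplus; exists b. Qed.

Lemma le_oplusr a b s : oplus a b = Some s -> b <= s.
Proof. by rewrite oplusC; exact: le_oplusl. Qed.

Lemma ea0_le a : ea0 <= a.
Proof. by apply: (@le_oplusl _ a); rewrite oplusC oplus0. Qed.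

Lemma le_ea0 a : a <= ea0 -> a = ea0.
Proof. by move=> a0; apply/le_anti; rewrite a0 ea0_le. Qed.

Lemma le_orth a b : a <= b -> orth b <= orth a.
Proof. by move=> /le_oplus[c /oplus_orth_sum]; exact: le_oplusr. Qed.

Lemma le_oplus2l a b c s t : oplus a b = Some s -> oplus a c = Some t ->
  s <= t -> b <= c.
Proof.
move=> ab ac /le_oplus[e se]; have [r br ar] := oplusAs ab se.
by rewrite (oplus_inj ac ar); exact: le_oplusl br.
Qed.

End EffectAlgebraTheory.

Section Properties.
Context {d : Order.disp_t}.

Definition atom (E : effectAlgebraType d) (a : E) : Prop :=
  a <> ea0 /\ forall b : E, b < a -> b = ea0.

Definition atomic (E : effectAlgebraType d) : Prop :=
  forall x : E, x <> ea0 -> exists2 a : E, atom a & a <= x.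

Definition omuln (E : effectAlgebraType d) (n : nat) (e : E) : option E :=
  iter n (obind (oplus e)) (Some ea0).

Definition archimedean (E : effectAlgebraType d) : Prop :=
  forall e : E, e <> ea0 -> ~ (forall n : nat, (0 < n)%N -> omuln n e).

Definition sharp (E : latticeEffectAlgebraType d) (x : E) : bool :=
  x `&` orth x == ea0.

Definition sharply_dominating (E : latticeEffectAlgebraType d) : Prop :=
  forall a : E, exists s : E,
    [/\ sharp s, a <= s & forall b : E, sharp b -> a <= b -> s <= b].

End Properties.

Section SharpElements.
Context {d : Order.disp_t} {E : latticeEffectAlgebraType d}.
Implicit Types a b w x y z : E.

Lemma sharp0 : sharp (ea0 : E).
Proof. by apply/eqP/le_ea0; rewrite leIl. Qed.

Lemma sharp_orth x : sharp x -> sharp (orth x).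
Proof. by rewrite /sharp orthK meetC. Qed.

Lemma sharp1 : sharp (ea1 : E).
Proof. by rewrite -orth0 sharp_orth ?sharp0. Qed.

Lemma sharp_le x w : sharp x -> w <= x -> w <= orth x -> w = ea0.
Proof. by move=> /eqP sx wx wx'; apply/le_ea0; rewrite -sx lexI wx. Qed.

Lemma oplus_le_disjoint a b s z : oplus a b = Some s ->
  a `&` b = ea0 -> a <= z -> b <= z -> s <= z.
Proof.
move=> ab ab0 az bz.
suff /eqP : s `&` z = s by move=> /eqP <-; exact: leIr.
have [ac bc] : a <= s `&` z /\ b <= s `&` z.
  by rewrite !lexI az bz (le_oplusl ab) (le_oplusr ab).
have /le_oplus[e ae] := ac; have /le_oplus[f bf] := bc.
have /le_oplus[g cg] : s `&` z <= s by exact: leIl.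
suff g0 : g = ea0 by move: cg; rewrite g0 oplus0 => -[].
have [r er ar] := oplusAs ae cg; have [q fq bq] := oplusAs bf cg.
rewrite (oplus_inj ar ab) in er.
rewrite oplusC in ab; rewrite (oplus_inj bq ab) in fq.
by apply/le_ea0; rewrite -ab0 lexI (le_oplusr er) (le_oplusr fq).
Qed.

Lemma sharp_oplus x y z : sharp x -> sharp y -> oplus x y = Some z -> sharp z.
Proof.
move=> sx sy xy; apply/eqP.
set w := z `&` orth z.
have [wz wz'] : w <= z /\ w <= orth z by split; [exact: leIl|exact: leIr].
have xz := le_oplusl xy; have yz := le_oplusr xy.
have wx' : w <= orth x by apply: le_trans wz' (le_orth xz).
have wy' : w <= orth y by apply: le_trans wz' (le_orth yz).
have xw0 : x `&` w = ea0.
  by apply: (sharp_le sx); [exact: leIl|apply: le_trans wx'; exact: leIr].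
have : oplus x w by rewrite oplus_definedE.
case xw : (oplus x w) => [s|//] _.
have sz := oplus_le_disjoint xw xw0 xz wz.
exact: sharp_le sy (le_oplus2l xw xy sz) wy'.
Qed.

Lemma sharp_diff x y z : sharp x -> sharp z -> oplus x y = Some z -> sharp y.
Proof.
move=> sx sz; rewrite oplusC => /oplus_orth_sum xz'.
by rewrite -[y]orthK sharp_orth// (sharp_oplus sx (sharp_orth sz) xz').
Qed.

End SharpElements.

Definition sharp_elements (d : Order.disp_t)
    (E : latticeEffectAlgebraType d) : Type := {x : E | sharp x}.

Section SharpEffectAlgebra.
Context {d : Order.disp_t} {E : latticeEffectAlgebraType d}.
Local Notation S := (sharp_elements E).
HB.instance Definition _ := SubChoice.on S.
HB.instance Definition _ := [SubChoice_isSubPOrder of S by <: with d].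
Implicit Types a b c : S.

(* [insub] never turns a defined sum into an undefined one; see
   [val_sharp_sum]. *)
Definition sharp_sum a b : option S := obind insub (oplus (val a) (val b)).

Lemma val_sharp_sum a b : omap val (sharp_sum a b) = oplus (val a) (val b).
Proof.
rewrite /sharp_sum; case ab : (oplus _ _) => [s|//] /=.
by rewrite insubT//= (sharp_oplus (valP a) (valP b) ab).
Qed.

Lemma sharp_sumP a b c :
  sharp_sum a b = Some c <-> oplus (val a) (val b) = Some (val c).
Proof.
rewrite -val_sharp_sum; split=> [->//|].
by case: (sharp_sum a b) => //= s [/val_inj ->].
Qed.

Definition sharp_zero : S := exist (fun x : E => sharp x) ea0 sharp0.
Definition sharp_one : S := exist (fun x : E => sharp x) ea1 sharp1.

Fact sharp_sumC a b : sharp_sum a b = sharp_sum b a.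
Proof. by rewrite /sharp_sum oplusC. Qed.

Fact sharp_sumA a b c :
  obind (fun s => sharp_sum s c) (sharp_sum a b) =
  obind (fun s => sharp_sum a s) (sharp_sum b c).
Proof.
apply: (@inj_omap _ _ val val_inj).
have := oplusA (val a) (val b) (val c); rewrite -!val_sharp_sum.
by case: (sharp_sum a b) => [s|]; case: (sharp_sum b c) => [t|] //=;
  rewrite -?val_sharp_sum.
Qed.

Fact sharp_orth_exists_unique a : exists! b, sharp_sum a b = Some sharp_one.
Proof.
exists (exist (fun x : E => sharp x) _ (sharp_orth (valP a))); split.
  by apply/sharp_sumP; exact: oplus_orth.
by move=> b /sharp_sumP /orth_unique vb; apply: val_inj; rewrite vb.
Qed.

Fact sharp_sum1_defined a : sharp_sum sharp_one a -> a = sharp_zero.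
Proof.
move=> h; apply/val_inj/oplus1_defined.
by have /= <- := val_sharp_sum sharp_one a; case: (sharp_sum _ _) h.
Qed.

Fact le_sharp_sum a b : a <= b <-> exists c, sharp_sum a c = Some b.
Proof.
rewrite -Order.le_val; split=> [/le_oplus[c ac]|[c /sharp_sumP]]; last exact: le_oplusl.
exists (exist (fun x : E => sharp x) c (sharp_diff (valP a) (valP b) ac)).
exact/sharp_sumP.
Qed.

HB.instance Definition _ := isEffectAlgebra.Build d S
  sharp_sumC sharp_sumA sharp_orth_exists_unique sharp_sum1_defined le_sharp_sum.

End SharpEffectAlgebra.

Definition is_state (R : realType) (d : Order.disp_t) (E : effectAlgebraType d)
    (w : E -> R) : Prop :=
  [/\ forall x, (0 <= w x <= 1)%R,
      w ea1 = 1%R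
    & forall x y z, oplus x y = Some z -> w z = (w x + w y)%R].

(* A net is a map from a type [I] directed by a relation [leI]. *)
Definition directed (I : Type) (leI : I -> I -> Prop) : Prop :=
  [/\ inhabited I, (forall i, leI i i),
      (forall i j k, leI i j -> leI j k -> leI i k)
    & forall i j, exists2 k, leI i k & leI j k].

Definition tails (I : Type) (leI : I -> I -> Prop) : set_system I :=
  filter_from setT (fun i => [set j | leI i j]).

Section OrderConvergence.
Context {d : Order.disp_t} {P : porderType d} {I : Type}.
Variable leI : I -> I -> Prop.
Implicit Types (x u v : I -> P) (a : P).

Definition increases_to u a : Prop :=
  (forall i j, leI i j -> u i <= u j) /\ supremums (range u) a.

Definition decreases_to v a : Prop :=
  (forall i j, leI i j -> v j <= v i) /\ infimums (range v) a.

Definition o_converges x a : Prop :=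
  exists u v, [/\ forall i, u i <= x i <= v i, increases_to u a
                & decreases_to v a].

End OrderConvergence.

Definition o_continuous (R : realType) (d : Order.disp_t) (P : porderType d)
    (w : P -> R) : Prop :=
  forall (I : Type) (leI : I -> I -> Prop), directed leI ->
  forall (x : I -> P) (a : P), o_converges leI x a ->
    w \o x @ tails leI --> w a.

(* Main.v *)
Require Import Defs.
From HB Require Import structures.
From mathcomp Require Import all_boot all_order all_algebra.
From mathcomp Require Import finmap.
From mathcomp Require Import all_classical all_reals all_analysis.

(** Call an element meager when [0] is the only sharp element below it.  Sharp
    domination writes every [x] in exactly one way as [s (+) r] with [s] sharp
    and [r] meager: [s] is the largest sharp element below [x].  An atom [a]
    has by the Archimedean property a largest existing multiple [n_a a], its
    saturation, and this multiple is sharp.  So a state extending [w] has to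
    give [a] the mass [w (n_a a) / n_a], and the extension is defined by

      [w' x = w s + sum over the atoms a of (k_a / n_a) * w (n_a a)]

    where [k_a] is the multiplicity of [a] in [r], the largest [k] for which
    [k a] exists and is below [r].  It agrees with [w] on sharp elements, whose
    meager part is [0], and the bound [w' <= 1] follows from additivity and
    [w' 1 = 1].

    Additivity reduces to a sum [z = r (+) q] of two meager elements, which
    need not be meager: let [z = u (+) m] with [u] sharp and [m] meager.  What
    makes this tractable is that two distinct atoms that are not orthogonal
    have a sharp join ([sharp_join_atoms]); hence the atoms below a meager
    element are pairwise orthogonal, and so are those below [r] or [q].  Call
    such an atom [a] filled when [n_a a <= z].  Then the multiplicities in [r]
    and in [q] add up to [n_a] if [a] is filled, and otherwise to the
    multiplicity in [m] ([mult_meager_part]).  The filled atoms are exactly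
    those that have migrated to [u]: no atom below [u] is orthogonal to all
    their saturations, so that [u] is the supremum of these saturations
    ([atom_below_sharp_part], [le_sup_saturations]).

    Order continuity enters only at the end: finite joins of the saturations of
    filled atoms are orthogonal sums, they increase to [u] in the sharp
    elements, and so [w u] is the sum of the [w (n_a a)] over the filled atoms
    ([esum_weight]).  Summing the identity for multiplicities over all atoms
    then gives additivity ([meager_massD]). *)

Set Implicit Arguments.
Unset Strict Implicit.
Unset Printing Implicit Defensive.

Import Order.TTheory GRing.Theory Num.Theory.
Import numFieldNormedType.Exports.

Local Open Scope classical_set_scope.
Local Open Scope order_scope.

(** * Partial sums and multiplicities in an effect algebra *)

Section PartialSum.
Context {d : Order.disp_t} {E : effectAlgebraType d}.
Implicit Types a b c x y z : E.

Lemma oplus_some a b : a <= orth b -> exists s, oplus a b = Some s.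
Proof.
by rewrite -oplus_definedE oplusC; case: (oplus a b) => [s|//] _; exists s.
Qed.

Lemma some_orth a b s : oplus a b = Some s -> a <= orth b.
Proof. by rewrite -oplus_definedE oplusC => ->. Qed.

Lemma orthC a b : (a <= orth b) = (b <= orth a).
Proof. by rewrite -!oplus_definedE [oplus b a]oplusC. Qed.

Lemma oplusAs_rev a b c r t : oplus b c = Some r -> oplus a r = Some t ->
  exists2 s, oplus a b = Some s & oplus s c = Some t.
Proof.
rewrite (oplusC b) (oplusC a r) => cb ra; have [s ba sc] := oplusAs cb ra.
by exists s; rewrite oplusC.
Qed.

Lemma oplusACA a b c e s t z : oplus a b = Some s -> oplus c e = Some t ->
  oplus s t = Some z -> exists s' t',
  [/\ oplus a c = Some s', oplus b e = Some t' & oplus s' t' = Some z].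
Proof.
move=> ab ce st; have [r bt ar] := oplusAs ab st.
have [r' bc r'e] := oplusAs_rev ce bt.
rewrite oplusC in bc; have [t' be ct'] := oplusAs bc r'e.
by have [s' ac s't'] := oplusAs_rev ct' ar; exists s', t'.
Qed.

Lemma atom_neq0 a : atom a -> a <> ea0. Proof. by case. Qed.

Lemma le_atom a b : atom a -> atom b -> b <= a -> b = a.
Proof.
move=> [_ aP] [b0 _]; rewrite le_eqVlt => /orP[/eqP//|/aP /b0 //].
Qed.

Lemma omulnS_some k a y : omuln k.+1 a = Some y <->
  exists2 y0, omuln k a = Some y0 & oplus a y0 = Some y.
Proof.
rewrite /omuln iterS; case: (iter _ _ _) => [y0|] /=; last by split=> // -[].
by split=> [ay|[? [<-]]//]; exists y0.
Qed.

Lemma omulnD k l a y z s : omuln k a = Some y -> omuln l a = Some z ->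
  oplus y z = Some s -> omuln (k + l) a = Some s.
Proof.
elim: k y s => [|k IH] y s.
  by move=> [<-] az; rewrite oplusC oplus0 => -[<-].
move=> /omulnS_some[y0 ky ay] az ys.
have [r yz ar] := oplusAs ay ys.
by apply/omulnS_some; exists r => //; exact: IH yz.
Qed.

Definition multiple_le k a x := exists2 y, omuln k a = Some y & y <= x.

(** The default [0] is never reached when [a <> ea0] in an Archimedean algebra
    (see [multP]). *)
Definition mult a x : nat :=
  xget 0%N [set k | multiple_le k a x /\ ~ multiple_le k.+1 a x].

(** The largest existing multiple of [a], the isotropic index of [a] being
    [mult a ea1]. *)
Definition saturation a : E := odflt ea0 (omuln (mult a ea1) a).

Lemma le_ea1 x : x <= ea1.
Proof. by apply/le_oplus; exists (orth x); exact: oplus_orth. Qed.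

Lemma multiple_leS k a x : multiple_le k.+1 a x -> multiple_le k a x.
Proof.
move=> [y /omulnS_some[y0 ky ay] yx]; exists y0 => //.
exact: le_trans (le_oplusr ay) yx.
Qed.

Context (archE : archimedean E).

(** The multiples of [a] form an increasing sequence, so those below [x] are an
    initial segment of it, finite by the Archimedean property. *)
Lemma multP k a x : a <> ea0 -> multiple_le k a x <-> (k <= mult a x)%N.
Proof.
move=> a0.
have mono i j : (i <= j)%N -> multiple_le j a x -> multiple_le i a x.
  move=> /subnK <-; elim: (j - i)%N => [//|n IH].
  by rewrite addSn => /multiple_leS.
rewrite /mult; case: xgetP => [m _ [mx mx']|nx].
  split=> [kx|/mono]; last exact.
  rewrite leqNgt; apply/negP => mk; apply: mx'; exact: mono mk kx.
exfalso; apply: (archE a0) => n _.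
suff [y -> //] : multiple_le n a x.
elim: n => [|n IH]; first by exists ea0 => //; exact: ea0_le.
by apply: contrapT => h; exact: (nx n).
Qed.

Lemma mult_some a x : a <> ea0 -> exists y r,
  [/\ omuln (mult a x) a = Some y, oplus y r = Some x & ~ a <= r].
Proof.
move=> a0; have /(multP _ _ a0)[y ky /le_oplus[r yr]] := leqnn (mult a x).
exists y, r; split=> // /le_oplus[e ae].
have : ~ (mult a x < mult a x)%N by rewrite ltnn.
apply; apply/(multP _ _ a0).
rewrite oplusC in yr; have [t ey at_] := oplusAs ae yr.
rewrite oplusC in ey; have [s ay sx] := oplusAs_rev ey at_.
by exists s; [apply/omulnS_some; exists y|exact: le_oplusl sx].
Qed.

Lemma mult_le a x y : a <> ea0 -> x <= y -> (mult a x <= mult a y)%N.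
Proof.
move=> a0 xy; apply/(multP _ _ a0).
have [v [e [kv ve _]]] := mult_some x a0.
by exists v => //; apply: le_trans xy; exact: le_oplusl ve.
Qed.

Lemma mult_gt0 a x : a <> ea0 -> a <= x -> (0 < mult a x)%N.
Proof.
move=> a0 ax; apply/(multP _ _ a0); exists a => //.
by apply/omulnS_some; exists ea0; rewrite ?oplus0.
Qed.

Lemma mult_eq0 a x : a <> ea0 -> ~ a <= x -> mult a x = 0%N.
Proof.
move=> a0 ax; apply/eqP; rewrite -leqn0 leqNgt; apply/negP.
by move=> /(multP _ _ a0)[y /omulnS_some[_ [<-]]]; rewrite oplus0 => -[<-].
Qed.

Lemma saturation_some a : a <> ea0 ->
  omuln (mult a ea1) a = Some (saturation a).
Proof. by move=> /(mult_some ea1)[y [r [ky _ _]]]; rewrite /saturation ky. Qed.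

Lemma saturation_max a : a <> ea0 -> ~ a <= orth (saturation a).
Proof.
move=> a0 /oplus_some[s as_].
have : ~ (mult a ea1 < mult a ea1)%N by rewrite ltnn.
apply; apply/(multP _ _ a0); exists s; last exact: le_ea1.
by apply/omulnS_some; exists (saturation a) => //; exact: saturation_some.
Qed.

Lemma mult_le_saturation a x : a <> ea0 -> (mult a x <= mult a ea1)%N.
Proof.
move=> a0; apply/(multP _ _ a0).
by have [y [_ [ky _ _]]] := mult_some x a0; exists y; last exact: le_ea1.
Qed.

Lemma multiple_le_saturation k a y : a <> ea0 -> omuln k a = Some y ->
  y <= saturation a.
Proof.
move=> a0 ky; have : (k <= mult a (saturation a))%N; last first.
  by move=> /(multP _ _ a0)[y']; rewrite ky => -[<-].
apply: (@leq_trans (mult a ea1)).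
  by apply/(multP _ _ a0); exists y => //; exact: le_ea1.
apply/(multP _ _ a0); exists (saturation a) => //; exact: saturation_some.
Qed.

Lemma atom_le_saturation a : a <> ea0 -> a <= saturation a.
Proof.
move=> a0; apply: (@multiple_le_saturation 1) => //.
by apply/omulnS_some; exists ea0; rewrite ?oplus0.
Qed.

End PartialSum.

(** * Atoms, sharp elements and meager elements *)

Section LatticeAtoms.
Context {d : Order.disp_t} {E : latticeEffectAlgebraType d}.
Implicit Types a b c s x y z : E.

Lemma atom_meet a x : atom a -> ~ a <= x -> a `&` x = ea0.
Proof.
move=> [_ aP] ax; apply: aP; rewrite lt_neqAle leIl andbT.
by apply/eqP => h; apply: ax; rewrite -h leIr.
Qed.

Lemma atom_oplus_le a b s z : atom a -> oplus a b = Some s -> ~ a <= b ->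
  a <= z -> b <= z -> s <= z.
Proof. by move=> aa ab nab; apply: oplus_le_disjoint ab _; exact: atom_meet. Qed.

(** With [s = x (+) t], the element [t] is the whole of [s `&` orth x]: what
    exceeds it would lie below both [s] and [orth s].  As [y] is below
    [s `&` orth x], it fits into the room [t] that [x] leaves in [s]. *)
Lemma sharp_principal s x y z : sharp s -> x <= s -> y <= s ->
  oplus x y = Some z -> z <= s.
Proof.
move=> ss xs ys xy; have /le_oplus[t xt] := xs.
have yx' : y <= orth x by rewrite -orthC; exact: some_orth xy.
suff yt : y <= t.
  have /le_oplus[e ye] := yt.
  have [q xy' qe] := oplusAs_rev ye xt.
  by move: xy'; rewrite xy => -[->]; exact: le_oplusl qe.
have tx' : t <= orth x by rewrite -orthC; exact: some_orth xt.
have ts : t <= s := le_oplusr xt.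
have /le_oplus[e te] : t <= s `&` orth x by rewrite lexI ts.
have e0 : e = ea0.
  apply: (sharp_le ss).
    by apply: le_trans (le_oplusr te) _; exact: leIl.
  have ts' : oplus t (orth s) = Some (orth x) by exact: oplus_orth_sum xt.
  by apply: le_oplus2l te ts' _; exact: leIr.
by move: te; rewrite e0 oplus0 => -[->]; rewrite lexI ys.
Qed.

Lemma sharp_multiple k a s y : sharp s -> a <= s -> omuln k a = Some y -> y <= s.
Proof.
move=> ss as_; elim: k y => [|k IH] y; first by move=> [<-]; exact: ea0_le.
by move=> /omulnS_some[y0 /IH y0s]; exact: sharp_principal.
Qed.

(** Both claims go up together along the multiples of [a]: as long as [b] is not
    below [k a], the sum of [b] and [k a] is their join, which stays orthogonal
    to [a]; and [b] cannot get below the next multiple, since the join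
    [a (+) b] would then be below it and cancelling [a] would put [b] below
    [k a]. *)
Lemma orthogonal_multiple k a b y : atom a -> atom b -> a <> b ->
  a <= orth b -> omuln k a = Some y -> ~ b <= y /\ y <= orth b.
Proof.
move=> aa ab nab aob; elim: k y => [|k IH] y.
  by move=> [<-]; split; [move/le_ea0; exact: atom_neq0|exact: ea0_le].
move=> /omulnS_some[y0 /IH[nby y0b] ay]; split.
  move=> bY; have [s abs] := oplus_some aob; apply: nby.
  apply: (le_oplus2l abs ay); apply: (atom_oplus_le aa abs) bY.
    by move/(le_atom ab aa).
  exact: le_oplusl ay.
have [t bt] : exists t, oplus b y0 = Some t by apply: oplus_some; rewrite orthC.
have ta : t <= orth a.
  apply: (atom_oplus_le ab bt) => //; first by rewrite orthC.
  by rewrite orthC; exact: some_orth ay.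
have [u au] : exists u, oplus a t = Some u by apply: oplus_some; rewrite orthC.
rewrite oplusC in bt.
by have [s] := oplusAs_rev bt au; rewrite ay => -[<-]; exact: some_orth.
Qed.

Definition meager x := forall s, sharp s -> s <= x -> s = ea0.

Context (atomE : atomic E).

Lemma sharp_atoms x : (forall a, atom a -> a <= x -> ~ a <= orth x) -> sharp x.
Proof.
move=> h; apply/eqP; apply: contrapT => /atomE[a aa]; rewrite lexI => /andP[].
exact: h.
Qed.

Lemma disjoint_atoms x y : (forall a, atom a -> a <= x -> ~ a <= y) ->
  x `&` y = ea0.
Proof.
move=> h; apply: contrapT => /atomE[a aa]; rewrite lexI => /andP[].
exact: h.
Qed.

(** An atom [e] below both [a `|` b] and its orthosupplement is orthogonal to
    [a] and to [b], and equal to neither.  So [e (+) a] and [e (+) b] are joins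
    below [a `|` b], whence [a] and [b] are already below [a `|` b] minus [e],
    which is absurd. *)
Lemma sharp_join_atoms a b : atom a -> atom b -> a <> b -> ~ a <= orth b ->
  sharp (a `|` b).
Proof.
move=> aa ab nab aob; apply: sharp_atoms => e ae eab eab'.
have ea' : e <= orth a by apply: le_trans eab' (le_orth _); exact: leUl.
have eb' : e <= orth b by apply: le_trans eab' (le_orth _); exact: leUr.
have /le_oplus[p ep] := eab.
suff abp : a `|` b <= p.
  apply: (atom_neq0 ae).
  have pe : p = a `|` b by apply/le_anti; rewrite abp (le_oplusr ep).
  by rewrite pe oplusC in ep; apply: (oplus_inj ep); rewrite oplus0.
have key c : atom c -> e <= orth c -> c <= a `|` b -> e <> c -> c <= p.
  move=> ac /oplus_some[s ec] cab nec; apply: (le_oplus2l ec ep).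
  by apply: (atom_oplus_le ae ec) => // /(le_atom ac ae).
rewrite leUx !key ?leUl ?leUr// => h.
- by apply: aob; rewrite orthC -h.
- by apply: aob; rewrite -h.
Qed.

Lemma meager_atoms x a b : meager x -> atom a -> atom b -> a <= x -> b <= x ->
  a <> b -> a <= orth b.
Proof.
move=> mx aa ab ax bx nab; apply: contrapT => aob.
apply: (atom_neq0 aa); apply: le_ea0.
by rewrite -(mx _ (sharp_join_atoms aa ab nab aob)) ?leUl// leUx ax bx.
Qed.

Context (archE : archimedean E).

(** An atom [b] below the saturation of [a] and orthogonal to it is orthogonal
    to [a]; it is not [a], whose saturation is maximal, and an atom other than
    [a] that is orthogonal to [a] is below no multiple of [a]. *)
Lemma sharp_saturation a : atom a -> sharp (saturation a).
Proof.
move=> aa; have a0 := atom_neq0 aa; apply: sharp_atoms => b ab ba ba'.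
have bo : b <= orth a.
  apply: le_trans ba' (le_orth _); exact: atom_le_saturation.
have [nab|nab] := pselect (a = b).
  by rewrite -nab in ba'; exact: saturation_max ba'.
rewrite orthC in bo.
by have [/(_ ba)] := orthogonal_multiple aa ab nab bo (saturation_some archE a0).
Qed.

Lemma saturation_le_sharp a s : atom a -> sharp s -> a <= s -> saturation a <= s.
Proof.
move=> aa ss as_; apply: sharp_multiple ss as_ (saturation_some archE _).
exact: atom_neq0.
Qed.

(** Orthogonality of an atom to a meager element can be tested on atoms.  Were [r1 = r `&` orth b]
    not the whole of [r], it could be increased inside [r] by an atom [a].
    Splitting off the multiple of [a] in [r1] writes [a (+) r1] as the sum of a
    multiple of [a] and an element disjoint from it, hence as a join of two
    elements of [orth b]: the increased element is still below [r1]. *)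
Lemma orthogonal_meager r b : meager r -> atom b -> ~ b <= r ->
  (forall a, atom a -> a <= r -> a <= orth b) -> r <= orth b.
Proof.
move=> mr ab nbr h.
have /le_oplus[u] : r `&` orth b <= r by exact: leIl.
set r1 := r `&` orth b => r1u.
have [u0|/atomE[a aa au]] := pselect (u = ea0).
  by move: r1u; rewrite u0 oplus0 => -[<-]; exact: leIr.
exfalso; have a0 := atom_neq0 aa; have ur := le_oplusr r1u.
have ar := le_trans au ur; have r1r := le_oplusl r1u.
have nab : a <> b by move=> e; apply: nbr; rewrite -e.
have [ya [r2 [ky yr nar2]]] := mult_some archE r1 a0.
have [t r1a tr] : exists2 t, oplus a r1 = Some t & t <= r.
  have /le_oplus[v av] := au; have [t rt tr] := oplusAs_rev av r1u.
  by exists t; [rewrite oplusC|exact: le_oplusl tr].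
have [y ay yt] := oplusAs_rev yr r1a.
have kSy : omuln (mult a r1).+1 a = Some y by apply/omulnS_some; exists ya.
have [nby yb] := orthogonal_multiple aa ab nab (h _ aa ar) kSy.
have yr2 : y `&` r2 = ea0.
  apply: disjoint_atoms => e ae ey er2.
  have er : e <= r := le_trans er2 (le_trans (le_oplusr yr) r1r).
  have nae : a <> e by move=> ea; apply: nar2; rewrite ea.
  have aoe := meager_atoms mr aa ae ar er nae.
  by have [] := orthogonal_multiple aa ae nae aoe kSy.
have tb : t <= orth b.
  apply: (oplus_le_disjoint yt yr2 yb).
  by apply: le_trans (le_oplusr yr) _; exact: leIr.
have tr1 : t <= r1 by rewrite lexI tr.
apply: a0; have tE : t = r1 by apply/le_anti; rewrite tr1 (le_oplusr r1a).
by rewrite tE oplusC in r1a; apply: (oplus_inj r1a); rewrite oplus0.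
Qed.

(** By [orthogonal_meager] the sum of [r] and [b] exists; it is their join, so
    it is below [z], and [r] can be cancelled. *)
Lemma atom_le_oplus r q z b : meager r -> oplus r q = Some z -> atom b ->
  b <= z -> ~ b <= r -> (forall a, atom a -> a <= r -> a <= orth b) -> b <= q.
Proof.
move=> mr rq ab bz nbr h.
have := orthogonal_meager mr ab nbr h; rewrite orthC => /oplus_some[s br].
have rb : oplus r b = Some s by rewrite oplusC.
apply: (le_oplus2l rb rq); apply: (atom_oplus_le ab br) => //.
exact: le_oplusl rq.
Qed.

Lemma meager_le x y : meager x -> y <= x -> meager y.
Proof. by move=> mx yx s ss sy; apply: mx => //; exact: le_trans yx. Qed.

(** An atom of [u] minus [t `&` u] would be orthogonal to the saturation of
    every element of [F], since all of these are below [t `&` u]. *)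
Lemma le_sup_saturations (F : set E) u t :
  (forall a, F a -> saturation a <= u) ->
  (forall b, atom b -> b <= u -> exists2 a, F a & ~ b <= orth (saturation a)) ->
  (forall a, F a -> saturation a <= t) -> u <= t.
Proof.
move=> Fu uF Ft; have /le_oplus[e ve] : t `&` u <= u by exact: leIr.
have [e0|/atomE[b ab be]] := pselect (e = ea0).
  by move: ve; rewrite e0 oplus0 => -[<-]; exact: leIl.
have [a Fa []] := uF _ ab (le_trans be (le_oplusr ve)).
apply: le_trans be _; rewrite orthC; apply: le_trans (some_orth ve).
by rewrite lexI Ft// Fu.
Qed.

Context (domE : sharply_dominating E).

(** The orthosupplement exchanges this with sharp domination. *)
Lemma largest_sharp_below x :
  exists k, [/\ sharp k, k <= x & forall t, sharp t -> t <= x -> t <= k].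
Proof.
have [t [st xt tP]] := domE (orth x).
exists (orth t); split; first exact: sharp_orth.
  by rewrite -[x]orthK; exact: le_orth.
by move=> y sy yx; rewrite orthC; apply: tP; [exact: sharp_orth|exact: le_orth].
Qed.

Lemma sharp_meager_decomposition x :
  exists s r, [/\ sharp s, meager r & oplus s r = Some x].
Proof.
have [k [sk /le_oplus[r kr] kP]] := largest_sharp_below x.
exists k, r; split=> // s ss /le_oplus[e se].
have [v ks vx] := oplusAs_rev se kr.
have vk : v <= k by apply: kP; [exact: sharp_oplus ks|exact: le_oplusl vx].
have vE : v = k by apply/le_anti; rewrite vk (le_oplusl ks).
by rewrite vE in ks; apply: (oplus_inj ks); rewrite oplus0.
Qed.

(** The largest sharp element below [x] exceeds [s] by a sharp element below
    [r], hence by [0]. *)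
Lemma le_sharp_part s r x t : sharp s -> meager r -> oplus s r = Some x ->
  sharp t -> t <= x -> t <= s.
Proof.
move=> ss mr sr st tx; have [k [sk /le_oplus[f kf] kP]] := largest_sharp_below x.
have /le_oplus[e se] : s <= k by apply: kP => //; exact: le_oplusl sr.
have [r' ef sr'] := oplusAs se kf.
have e0 : e = ea0.
  apply: mr; first exact: sharp_diff se.
  by rewrite (oplus_inj sr sr'); exact: le_oplusl ef.
by move: se; rewrite e0 oplus0 => -[->]; exact: kP.
Qed.

(** * The sum of two meager elements *)

Section SumOfMeager.
Context (r q z u m : E).
Context (mr : meager r) (mq : meager q) (rq : oplus r q = Some z).
Context (su : sharp u) (mm : meager m) (um : oplus u m = Some z).

Let supp a : Prop := a <= r \/ a <= q.

Lemma summand_atoms_orthogonal a b : atom a -> atom b -> supp a -> supp b ->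
  a <> b -> a <= orth b.
Proof.
have rq' : r <= orth q := some_orth rq.
move=> aa ab [ar|aq] [br|bq] nab.
- exact: (meager_atoms mr).
- by apply: le_trans ar (le_trans rq' _); exact: le_orth.
- by rewrite orthC; apply: le_trans br (le_trans rq' _); exact: le_orth.
- exact: (meager_atoms mq).
Qed.

Lemma mult_oplus_ge a : atom a -> (mult a r + mult a q <= mult a z)%N.
Proof.
move=> aa; have a0 := atom_neq0 aa.
have [y [r0 [ky yr _]]] := mult_some archE r a0.
have [y' [q0 [ky' yq _]]] := mult_some archE q a0.
have [s [t [yy' _ st]]] := oplusACA yr yq rq.
apply/(multP archE _ _ a0); exists s; last exact: le_oplusl st.
exact: omulnD yy'.
Qed.

(** If one more copy of [a] were below [z], it would be below [r0 (+) q0], where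
    [r0] and [q0] are what remains of [r] and [q] once all the copies of [a] are
    removed; then [a] would be below [q0] by [atom_le_oplus],
    although no copy of [a] is left in [q0]. *)
Lemma mult_oplus_le a : atom a -> supp a -> (mult a z <= mult a r + mult a q)%N.
Proof.
move=> aa Aa; have a0 := atom_neq0 aa.
have [y [r0 [ky yr nar]]] := mult_some archE r a0.
have [y' [q0 [ky' yq naq]]] := mult_some archE q a0.
have [s [t [yy' rq0 st]]] := oplusACA yr yq rq.
rewrite leqNgt; apply/negP => /(multP archE _ _ a0)[v].
move=> /omulnS_some[s']; rewrite (omulnD ky ky' yy') => -[<-] as_ vz.
rewrite oplusC in as_; have at_ := le_oplus2l as_ st vz.
apply: naq; apply: atom_le_oplus rq0 _ _ _ _ => //.
  by apply: meager_le mr _; exact: le_oplusr yr.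
move=> b ab br0; apply: summand_atoms_orthogonal => //.
  by left; apply: le_trans br0 (le_oplusr yr).
by move=> e; apply: nar; rewrite -e.
Qed.

Definition filled : set E :=
  [set a | [/\ atom a, supp a & saturation a <= z]].

Lemma mult_filled a : filled a -> (mult a r + mult a q = mult a ea1)%N.
Proof.
move=> [aa Aa az]; have a0 := atom_neq0 aa; apply/eqP.
rewrite eqn_leq (leq_trans (mult_oplus_ge aa) (mult_le_saturation archE _ a0)) /=.
apply: leq_trans (mult_oplus_le aa Aa); apply/(multP archE _ _ a0).
by exists (saturation a) => //; exact: saturation_some.
Qed.

(** If [a] and [b] are not orthogonal, their join is sharp and below [z], and it
    contains the saturation of its atom [a]. *)
Lemma filled_or_orthogonal a b : atom a -> atom b -> supp a -> b <= z -> a <> b ->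
  filled a \/ a <= orth b.
Proof.
move=> aa ab Aa bz nab; have [|nao] := pselect (a <= orth b); first by right.
left; split=> //; apply: (@le_trans _ _ (a `|` b)).
  by apply: saturation_le_sharp; rewrite ?leUl//; exact: sharp_join_atoms.
rewrite leUx bz andbT.
by case: Aa => h; [apply: le_trans (le_oplusl rq)|apply: le_trans (le_oplusr rq)].
Qed.

(** If [b] is not below [r], then it is orthogonal to the atoms of [r], the
    filled ones by assumption and the others by [filled_or_orthogonal], so it is
    below [q]. *)
Lemma atom_outside_filled b : atom b -> b <= z ->
  (forall a, filled a -> b <= orth (saturation a)) -> supp b /\ ~ filled b.
Proof.
move=> ab bz h; have b0 := atom_neq0 ab; split; last first.
  by move=> fb; exact: (saturation_max archE b0 (h _ fb)).
apply: contrapT => nAb; apply: (nAb); right.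
apply: (atom_le_oplus mr rq) => //; first by move=> br; apply: nAb; left.
move=> a aa ar; have nab : a <> b by move=> e; apply: nAb; left; rewrite -e.
have [fa|//] := filled_or_orthogonal aa ab (or_introl ar) bz nab.
rewrite orthC; apply: le_trans (h _ fa) (le_orth _).
exact: atom_le_saturation archE _ (atom_neq0 aa).
Qed.

Lemma saturation_filled a : filled a -> saturation a <= u.
Proof.
by move=> [aa _ az]; apply: (le_sharp_part su mm um) => //; exact: sharp_saturation.
Qed.

(** By [atom_outside_filled] an atom orthogonal to all these saturations is below
    [r] or [q] without being filled; but a sharp element contains the saturation
    of each of its atoms, so below [u] such an atom is filled. *)
Lemma atom_below_sharp_part b : atom b -> b <= u ->
  exists2 a, filled a & ~ b <= orth (saturation a).
Proof.
move=> ab bu; apply: contrapT => h; have uz := le_oplusl um.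
have [Ab []] : supp b /\ ~ filled b.
  apply: atom_outside_filled => // [|a fa]; first exact: le_trans uz.
  by apply: contrapT => nb; apply: h; exists a.
by split=> //; apply: le_trans uz; exact: saturation_le_sharp.
Qed.

Lemma filled_orthogonal a b : filled a -> filled b -> a <> b ->
  saturation a <= orth (saturation b).
Proof.
move=> [aa Aa _] [ab Ab _] nab; apply: saturation_le_sharp => //.
  by apply: sharp_orth; exact: sharp_saturation.
have aob := summand_atoms_orthogonal ab aa Ab Aa (nesym nab).
rewrite orthC; have b0 := atom_neq0 ab.
by have [] := orthogonal_multiple ab aa (nesym nab) aob (saturation_some archE b0).
Qed.

(** The saturation of [a] is orthogonal to those of the filled atoms, and [u] is
    the supremum of these. *)
Lemma sharp_part_orthogonal a : atom a -> supp a -> ~ filled a ->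
  u <= orth (saturation a).
Proof.
move=> aa Aa nfa.
apply: (le_sup_saturations saturation_filled atom_below_sharp_part) => b fb.
have [ab Ab _] := fb; have b0 := atom_neq0 ab.
have nba : b <> a by move=> e; apply: nfa; rewrite -e.
rewrite orthC; apply: saturation_le_sharp => //.
  by apply: sharp_orth; exact: sharp_saturation.
have boa := summand_atoms_orthogonal ab aa Ab Aa nba.
rewrite orthC.
by have [] := orthogonal_multiple ab aa nba boa (saturation_some archE b0).
Qed.

Lemma atom_below_meager_part a : atom a -> a <= m -> supp a /\ ~ filled a.
Proof.
move=> aa am; apply: atom_outside_filled => // [|b fb].
  by apply: le_trans am _; exact: le_oplusr um.
apply: le_trans am _; rewrite orthC; apply: le_trans (saturation_filled fb) _.
exact: some_orth um.
Qed.

(** A filled atom is used up entirely by [u], while an atom of [r] or [q] that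
    is not filled is orthogonal to [u], so that all its copies in [z] are in [m]. *)
Lemma mult_meager_part a : atom a ->
  (mult a r + mult a q =
   mult a m + (if `[< filled a >] then mult a ea1 else 0))%N.
Proof.
move=> aa; have a0 := atom_neq0 aa; case: asboolP => [fa|nfa].
  rewrite mult_filled// (@mult_eq0 _ _ archE a m)//.
  by move=> /(atom_below_meager_part aa)[].
rewrite addn0; have [Aa|nAa] := pselect (supp a); last first.
  rewrite !mult_eq0// => [/(atom_below_meager_part aa)[]//|h|h]; apply: nAa.
    by right.
  by left.
apply/eqP; rewrite eqn_leq; apply/andP; split; last first.
  by apply: leq_trans (mult_oplus_le aa Aa); apply: (mult_le archE) => //;
    exact: le_oplusr um.
apply: leq_trans (mult_oplus_ge aa) _; apply/(multP archE _ _ a0).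
have [y [e [ky ye _]]] := mult_some archE z a0.
exists y => //; have yu : y <= orth u.
  rewrite orthC; apply: le_trans (sharp_part_orthogonal aa Aa nfa) _.
  by apply: le_orth; exact: multiple_le_saturation ky.
have [t yt] := oplus_some yu; rewrite oplusC in yt.
apply: (le_oplus2l yt um); apply: (oplus_le_disjoint yt).
- apply: (sharp_le su); first exact: leIl.
  by apply: le_trans yu; exact: leIr.
- exact: le_oplusl um.
- exact: le_oplusl ye.
Qed.

End SumOfMeager.

End LatticeAtoms.

(** * Continuous states and suprema of saturations *)

Section FiniteJoins.
Context {d : Order.disp_t} {E : latticeEffectAlgebraType d}.
Implicit Types (a x t : E) (l : seq E).

Definition saturation_join l : E :=
  foldr (fun a y => saturation a `|` y) ea0 l.

Lemma saturation_join_le l t :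
  saturation_join l <= t <-> forall a, a \in l -> saturation a <= t.
Proof.
elim: l => [|a l IH] /=; first by split=> // _; exact: ea0_le.
rewrite leUx; split=> [/andP[at_ /IH lt] b|h].
  by rewrite inE => /predU1P[->|/lt].
rewrite h ?mem_head//=; apply/IH => b bl; apply: h.
by rewrite inE bl orbT.
Qed.

End FiniteJoins.

Section StateOnSharp.
Context {R : realType} {d : Order.disp_t} {E : latticeEffectAlgebraType d}.
Context (archE : archimedean E) (atomE : atomic E).
Local Notation S := (sharp_elements E).
Context (w : S -> R) (wstate : is_state w).

Definition to_sharp (x : E) : S := insubd sharp_zero x.

Lemma to_sharpK x : sharp x -> val (to_sharp x) = x.
Proof. by move=> sx; rewrite /to_sharp val_insubd sx. Qed.

Lemma state0 : w ea0 = 0%R.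
Proof.
have [_ _ wD] := wstate; have := wD ea0 ea0 ea0 (oplus0 _).
by move/eqP; rewrite -subr_eq subrr eq_sym => /eqP.
Qed.

Lemma state_le (x y : S) : x <= y -> (w x <= w y)%R.
Proof.
have [w01 _ wD] := wstate.
by move=> /le_oplus[z /wD ->]; rewrite lerDl; case/andP: (w01 z).
Qed.

Definition weight (a : E) : R := w (to_sharp (saturation a)).

Lemma weight_ge0 a : (0 <= weight a)%R.
Proof. by have [/(_ (to_sharp (saturation a)))/andP[]] := wstate. Qed.

Context (F : set E) (u : S).
Context (Fatom : forall a, F a -> atom a).
Context (Forth : forall a b, F a -> F b -> a <> b ->
  saturation a <= orth (saturation b)).
Context (Fu : forall a, F a -> saturation a <= val u).
Context (uF : forall b, atom b -> b <= val u ->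
  exists2 a, F a & ~ b <= orth (saturation a)).

(** Pairwise orthogonality makes the join an orthogonal sum: the join of the
    saturations in the tail is below the orthosupplement of the first one. *)
Lemma state_saturation_join l : uniq l -> (forall a, a \in l -> F a) ->
  sharp (saturation_join l) /\
  w (to_sharp (saturation_join l)) = (\sum_(a <- l) weight a)%R.
Proof.
elim: l => [|a l IH] /=.
  move=> _ _; split; first exact: sharp0.
  rewrite big_nil -state0; congr w; apply: val_inj.
  by rewrite to_sharpK//; exact: sharp0.
move=> /andP[al ul] lF.
have Fl b : b \in l -> F b by move=> bl; apply: lF; rewrite inE bl orbT.
have Fa : F a by apply: lF; rewrite mem_head.
have [sl wl] := IH ul Fl.
have sa := sharp_saturation atomE archE (Fatom Fa).
have la : saturation_join l <= orth (saturation a).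
  apply/saturation_join_le => b bl; apply: Forth => //; first exact: Fl.
  by move=> e; move: al; rewrite -e bl.
have [v av] := oplus_some la; rewrite oplusC in av.
have vE : v = saturation a `|` saturation_join l.
  apply/le_anti; rewrite leUx (le_oplusl av) (le_oplusr av) !andbT.
  apply: (oplus_le_disjoint av); rewrite ?leUl ?leUr//.
  apply: (sharp_le sa); first exact: leIl.
  by apply: le_trans la; exact: leIr.
have sv := sharp_oplus sa sl av; rewrite -vE; split=> //.
have [_ _ wD] := wstate; rewrite big_cons -wl; apply: wD.
by apply/sharp_sumP; rewrite !to_sharpK.
Qed.

(** [u] is the limit of the increasing net of joins over finite lists of atoms,
    and on such a join [w] is the sum of the weights.  Monotonicity of [w]
    bounds the sum by [w u], continuity gives the converse. *)
Lemma esum_weight : o_continuous w ->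
  (\esum_(a in F) (weight a)%:E)%R = (w u)%:E.
Proof.
move=> wcont.
(* Lists of arbitrary elements index the net, so that inclusion of lists
   directs it; only the members in [F] count, each once. *)
pose lF l := undup [seq a <- l | `[< F a >]].
have lFE l a : (a \in lF l) = `[< F a >] && (a \in l).
  by rewrite mem_undup mem_filter.
have lFF l a : a \in lF l -> F a by rewrite lFE => /andP[/asboolP].
pose J l := to_sharp (saturation_join (lF l)).
have JE l : val (J l) = saturation_join (lF l) /\
    w (J l) = (\sum_(a <- lF l) weight a)%R.
  have [sl wl] := state_saturation_join (undup_uniq _) (@lFF l).
  by rewrite to_sharpK.
have Jle l t : val (J l) <= t <-> forall a, a \in l -> F a -> saturation a <= t.
  rewrite (JE l).1 saturation_join_le; split=> h a; last first.
    by rewrite lFE => /andP[/asboolP Fa al]; exact: h.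
  by move=> al Fa; apply: h; rewrite lFE al asboolT.
pose leI (l l' : seq E) := {subset l <= l'}.
have dirI : directed leI.
  split=> [|l a//|l1 l2 l3 h1 h2 a /h1/h2//|l l']; first exact: inhabits [::].
  by exists (l ++ l') => a; rewrite mem_cat => ->; rewrite ?orbT.
have Ju l : J l <= u.
  by rewrite -Order.le_val; apply/Jle => a _; exact: Fu.
have Jcvg : o_converges leI J u.
  exists J, (fun=> u); split=> [l'||]; first by rewrite lexx Ju.
    split=> [l l' ll'|].
      rewrite -Order.le_val; apply/Jle => a /ll' al'.
      by apply: (Jle l' _).1 => //; exact: lexx.
    split=> [_ [l _ <-]//|t tJ]; rewrite -Order.le_val.
    apply: (le_sup_saturations atomE Fu uF) => a Fa.
    have := tJ (J [:: a]) (ex_intro2 _ _ [:: a] I erefl).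
    by rewrite -Order.le_val => /Jle; apply; rewrite ?mem_head.
  split=> [//|]; split=> [_ [_ _ <-]//|t tu].
  by apply: tu; exists [::].
apply/le_anti/andP; split.
  apply: ub_ereal_sup => _ [G [finG GF] <-].
  rewrite (fsbig_finite _ _ finG)/= sumEFin lee_fin.
  have mG a : a \in fset_set G -> F a.
    by rewrite in_fset_set// inE => /GF.
  have [sG <-] := state_saturation_join (fset_uniq _) mG.
  apply: state_le; rewrite -Order.le_val to_sharpK//.
  by apply/saturation_join_le => a /mG; exact: Fu.
apply/lee_addgt0Pr => e e0.
have [l _ lP] := wcont _ _ dirI J u Jcvg _ (nbhsx_ballx (w u) e e0).
have := lP l (fun=> id); rewrite /ball/= ltr_norml => /andP[_].
rewrite ltrBlDr => /ltW wJ.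
have Jsum : ((w (J l))%:E <= (\esum_(a in F) (weight a)%:E)%R)%E.
  apply: esum_ge; exists [set` lF l].
    by split; [exact: finite_seq|move=> a /lFF].
  by rewrite -fsbig_seq ?undup_uniq// (JE l).2 sumEFin.
apply: le_trans (leeD2r _ Jsum).
by rewrite -EFinD lee_fin addrC.
Qed.

End StateOnSharp.

(** * The extended state *)

Section Extension.
Context {R : realType} {d : Order.disp_t} {E : latticeEffectAlgebraType d}.
Context (domE : sharply_dominating E).
Context (archE : archimedean E) (atomE : atomic E).
Local Notation S := (sharp_elements E).
Context (w : S -> R) (wstate : is_state w) (wcont : o_continuous w).

(** The share [k_a / n_a] of the weight of [a] that the multiplicity of [a] in
    [x] accounts for. *)
Definition smear (x a : E) : R :=
  ((mult a x)%:R / (mult a ea1)%:R * weight w a)%R.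

(** The sum is taken in the extended reals, which postpones the question of
    finiteness until additivity and the value at [ea1] bound the extension
    by [1]. *)
Definition meager_mass (x : E) : \bar R :=
  (\esum_(a in [set a : E | atom a]) (smear x a)%:E)%R.

Lemma smear_ge0 x a : (0 <= smear x a)%R.
Proof. by rewrite /smear mulr_ge0 ?weight_ge0 ?divr_ge0. Qed.

Lemma meager_mass_ge0 x : (0 <= meager_mass x)%E.
Proof. by apply: esum_ge0 => a _; rewrite lee_fin smear_ge0. Qed.

Lemma meager_mass0 : meager_mass ea0 = 0%E.
Proof.
apply: esum1 => a aa; have a0 := atom_neq0 aa.
by rewrite /smear (mult_eq0 archE a0) ?mul0r// => /le_ea0.
Qed.

(** The identity [mult_meager_part], divided by [n_a] and weighted, is summed
    over the atoms; the filled atoms contribute [w u]. *)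
Lemma meager_massD r q z u m : meager r -> meager q -> oplus r q = Some z ->
  meager m -> oplus (val u) m = Some z ->
  (meager_mass r + meager_mass q = (w u)%:E + meager_mass m)%E.
Proof.
move=> mr mq rq mm um; have su := valP u.
have Fatom a : filled r q z a -> atom a by case.
rewrite -(esum_weight archE atomE wstate Fatom
  (@filled_orthogonal _ _ atomE archE r q z mr mq rq)
  (@saturation_filled _ _ atomE archE domE r q z (val u) m su mm um)
  (@atom_below_sharp_part _ _ atomE archE r q z (val u) m mr rq su um) wcont).
have -> : filled r q z = [set a | atom a] `&` filled r q z.
  by apply/seteqP; split=> a => [fa|[]//]; split=> //; exact: Fatom.
rewrite esum_mkcondr /meager_mass -!esumD.
- apply: eq_esum => a aa; have a0 := atom_neq0 aa.
  have n0 : ((mult a ea1)%:R != 0 :> R)%R.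
    by rewrite pnatr_eq0 -lt0n; apply: mult_gt0 => //; exact: le_ea1.
  rewrite /smear -EFinD -mulrDl -mulrDl -natrD.
  rewrite (mult_meager_part atomE archE domE mr mq rq su mm um aa).
  rewrite natrD !mulrDl addrC EFinD; congr (_ + _)%E.
  case: asboolP => [fa|nfa]; first by rewrite mem_set// divff// mul1r.
  by rewrite memNset// !mul0r.
- by move=> a _; case: ifP => // _; rewrite lee_fin weight_ge0.
- by move=> a _; rewrite lee_fin smear_ge0.
- by move=> a _; rewrite lee_fin smear_ge0.
- by move=> a _; rewrite lee_fin smear_ge0.
Qed.

Lemma sharp_decomposition x :
  exists p : S * E, meager p.2 /\ oplus (val p.1) p.2 = Some x.
Proof.
have [s [r [ss mr sr]]] := sharp_meager_decomposition domE x.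
by exists (exist (fun y : E => sharp y) s ss, r).
Qed.

Definition parts x : S * E := projT1 (cid (sharp_decomposition x)).

Definition extension (x : E) : \bar R :=
  ((w (parts x).1)%:E + meager_mass (parts x).2)%E.

Lemma extensionE (s : S) r x : meager r -> oplus (val s) r = Some x ->
  extension x = ((w s)%:E + meager_mass r)%E.
Proof.
rewrite /extension /parts; case: cid => -[s' r'] /= [mr' sr'] mr sr.
have ss' : s = s'.
  apply/val_inj/le_anti/andP; split.
    by apply: (le_sharp_part domE _ mr' sr'); rewrite ?valP//; exact: le_oplusl sr.
  by apply: (le_sharp_part domE _ mr sr); rewrite ?valP//; exact: le_oplusl sr'.
by rewrite -ss' in sr' *; rewrite (oplus_inj sr sr').
Qed.

Lemma extension_sharp (s : S) : extension (val s) = (w s)%:E.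
Proof.
rewrite (@extensionE s ea0) ?oplus0// ?meager_mass0 ?adde0//.
by move=> t _ /le_ea0.
Qed.

Lemma extensionD x y z : oplus x y = Some z ->
  (extension z = extension x + extension y)%E.
Proof.
move=> xy; have [_ _ wD] := wstate.
have [[s r] /= [mr sr]] := sharp_decomposition x.
have [[t q] /= [mq tq]] := sharp_decomposition y.
have [st [rq [stE rqE xyE]]] := oplusACA sr tq xy.
have [[u m] /= [mm um]] := sharp_decomposition rq.
have [v stu vm] := oplusAs_rev um xyE.
have sst := sharp_oplus (valP s) (valP t) stE.
have sv := sharp_oplus sst (valP u) stu.
have wst : w (to_sharp st) = (w s + w t)%R.
  by apply: wD; apply/sharp_sumP; rewrite to_sharpK.
have wv : w (to_sharp v) = (w (to_sharp st) + w u)%R.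
  by apply: wD; apply/sharp_sumP; rewrite !to_sharpK.
rewrite (extensionE mr sr) (extensionE mq tq).
rewrite (@extensionE (to_sharp v) m) ?to_sharpK//.
rewrite addeACA (meager_massD mr mq rqE mm um) wv wst !EFinD.
by rewrite addeA.
Qed.

Lemma extension_ge0 x : (0 <= extension x)%E.
Proof.
have [w01 _ _] := wstate; rewrite adde_ge0 ?meager_mass_ge0// lee_fin.
by case/andP: (w01 (parts x).1).
Qed.

Lemma extension1 : extension ea1 = 1%E.
Proof. by have [_ w1 _] := wstate; rewrite (extension_sharp ea1) w1. Qed.

Lemma extension_le1 x : (extension x <= 1)%E.
Proof. by rewrite -extension1 (extensionD (oplus_orth x)) leeDl ?extension_ge0. Qed.

Lemma extension_fin_num x : extension x \is a fin_num.
Proof.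
rewrite ge0_fin_numE ?extension_ge0//.
by apply: le_lt_trans (extension_le1 x) _; exact: ltry.
Qed.

End Extension.

Theorem theorem4p2 (R : realType) (d : Order.disp_t)
    (E : latticeEffectAlgebraType d) :
  sharply_dominating E -> archimedean E -> atomic E ->
  forall w : sharp_elements E -> R, is_state w -> o_continuous w ->
  exists w' : E -> R,
    is_state w' /\ forall x : sharp_elements E, w' (val x) = w x.
Proof.
move=> domE archE atomE w wstate wcont.
have fin x := extension_fin_num domE archE atomE wstate wcont x.
exists (fun x => fine (extension domE w x)); split; last first.
  by move=> x; rewrite extension_sharp.
split=> [x||x y z xy].
- rewrite -!lee_fin fineK ?fin// extension_ge0//=.
  exact: extension_le1.
- by rewrite extension1.
- by rewrite (extensionD domE archE atomE wstate wcont xy) fineD ?fin.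
Qed.
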